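(* For a complex-valued function $\phi$ on $X$ (a Riemannian manifold or a graph) and an integer $N\ge 1$, let $( * )_N$ denote the condition $\Delta\phi=\Delta\phi^2=\dots=\Delta\phi^N=0$, and let $( * )_\infty$ denote the condition that $\Delta\phi^k=0$ for all integers $k\ge 1$. Then: (1) For every Riemannian manifold $X$ and every $\phi:X\to\mathbb{C}$, $( * )_2$ implies $( * )_\infty$. That is, a holomorphic function on a Riemannian manifold satisfies $( * )_N$ for every $N$. (2) For every integer $N>2$ there exist a graph $X$ and a holomorphic function $\phi:X\to\mathbb{C}$ which satisfies $( * )_N$ but does not satisfy $( * )_{N+1}$. (3) For every connected graph $X$ of finite (i.e. bounded) valency there is a finite integer $m=m(X)$ such that every function $\phi:X\to\mathbb{C}$ satisfying $( * )_m$ is constant (and hence trivially satisfies $( * )_\infty$).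
   Context: Functions on a Riemannian manifold are smooth and $\Delta$ is the Laplace–Beltrami operator, applied to complex-valued functions by complex linearity. Functions on a graph are defined on its vertices (each vertex having finite valency), and the Laplacian is $$\Delta f(x)=\frac{1}{\nu(x)}\sum_{y\sim x}\bigl(f(y)-f(x)\bigr),$$ where $y\sim x$ means that $y$ is adjacent to $x$ and $\nu(x)$ is the valency of $x$. A function $f$ is harmonic if $\Delta f=0$. Here $\phi^k$ is the pointwise $k$-th power. A function $\phi:X\to\mathbb{C}$ is called holomorphic if both $\phi$ and $\phi^2$ are harmonic, i.e. if it satisfies $( * )_2$. *)

(* Defs.v *)
From mathcomp Require Import all_boot all_order all_algebra finmap.
From mathcomp Require Import complex.
From mathcomp Require Import all_classical all_reals all_analysis.

Set Implicit Arguments.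
Unset Strict Implicit.
Unset Printing Implicit Defensive.

Import Order.TTheory GRing.Theory Num.Theory.
Import numFieldNormedType.Exports.

Local Open Scope classical_set_scope.
Local Open Scope ring_scope.

Section Calculus.
Variables (R : realType) (n : nat).
Implicit Types (u : 'rV[R]_n -> R) (A : set 'rV[R]_n).

Definition partial (i : 'I_n) u : 'rV[R]_n -> R :=
  fun x => 'D_(delta_mx 0 i) u x.

(* All iterated partial derivatives, of every order and in every sequence of
   directions, exist and are continuous at the points of A. Meant for A open,
   where only the values of u on A matter. *)
Definition smooth_on A u : Prop :=
  forall (s : seq 'I_n) (x : 'rV[R]_n), A x ->
    {for x, continuous (foldr partial u s)} /\
    forall i : 'I_n, derivable (foldr partial u s) x (delta_mx 0 i).

(* (det G)^(-1/2) * sum_i d_i ((det G)^(1/2) * sum_j G^ij d_j u), for a metric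
   with coordinate matrix G *)
Definition laplace_coord (G : 'rV[R]_n -> 'M[R]_n) u : 'rV[R]_n -> R :=
  let vol y := Num.sqrt (\det (G y)) in
  fun x => (vol x)^-1 *
    \sum_i partial i
      (fun y => vol y * \sum_j invmx (G y) i j * partial j u y) x.

End Calculus.

(* A chart is a homeomorphism between an open subset of M and an open subset
   of R^n; both maps are total, with irrelevant values outside these sets. *)
Record chart (R : realType) (n : nat) (M : topologicalType) := Chart {
  chart_dom : set M;
  chart_cod : set 'rV[R]_n;
  chart_map : M -> 'rV[R]_n;
  chart_inv : 'rV[R]_n -> M;
  chart_dom_open : open chart_dom;
  chart_cod_open : open chart_cod;
  chart_map_cod : forall p, chart_dom p -> chart_cod (chart_map p);
  chart_inv_dom : forall x, chart_cod x -> chart_dom (chart_inv x);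
  chart_mapK : forall p, chart_dom p -> chart_inv (chart_map p) = p;
  chart_invK : forall x, chart_cod x -> chart_map (chart_inv x) = x;
  chart_map_continuous :
    forall p, chart_dom p -> {for p, continuous chart_map};
  chart_inv_continuous :
    forall x, chart_cod x -> {for x, continuous chart_inv}
}.

Section Transition.
Variables (R : realType) (n : nat) (M : topologicalType).
Implicit Types c d : chart R n M.

Definition overlap c d : set 'rV[R]_n :=
  [set x | chart_cod c x /\ chart_dom d (chart_inv c x)].

Definition transition c d : 'rV[R]_n -> 'rV[R]_n :=
  chart_map d \o chart_inv c.

(* row index: variable of differentiation; column index: component *)
Definition transition_jacobian c d (x : 'rV[R]_n) : 'M[R]_n :=
  \matrix_(i, j) partial i (fun y => transition c d y 0 j) x.

End Transition.

(* The metric is given by its matrix in each chart of the atlas; metric_compat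
   is the transformation law of a covariant 2-tensor. *)
Record riemannianManifold (R : realType) (n : nat) := RiemannianManifold {
  manifold_sort :> topologicalType;
  manifold_hausdorff : hausdorff_space manifold_sort;
  manifold_countable : @second_countable manifold_sort;
  atlas_index : Type;
  atlas : atlas_index -> chart R n manifold_sort;
  chart_at : manifold_sort -> atlas_index;
  mem_chart_at : forall p, chart_dom (atlas (chart_at p)) p;
  transition_smooth : forall (a b : atlas_index) (j : 'I_n),
    smooth_on (overlap (atlas a) (atlas b))
      (fun x => transition (atlas a) (atlas b) x 0 j);
  metric : atlas_index -> 'rV[R]_n -> 'M[R]_n;
  metric_smooth : forall (a : atlas_index) (i j : 'I_n),
    smooth_on (chart_cod (atlas a)) (fun x => metric a x i j);
  metric_sym : forall (a : atlas_index) (x : 'rV[R]_n),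
    chart_cod (atlas a) x -> (metric a x)^T = metric a x;
  metric_pos : forall (a : atlas_index) (x v : 'rV[R]_n),
    chart_cod (atlas a) x -> v != 0 ->
    0 < (v *m metric a x *m v^T) 0 0;
  metric_compat : forall (a b : atlas_index) (x : 'rV[R]_n),
    overlap (atlas a) (atlas b) x ->
    let J := transition_jacobian (atlas a) (atlas b) x in
    metric a x = J *m metric b (transition (atlas a) (atlas b) x) *m J^T
}.

Section ManifoldFunctions.
Variables (R : realType) (n : nat) (X : riemannianManifold R n).

Definition smooth_real (f : X -> R) : Prop :=
  forall a : atlas_index X,
    smooth_on (chart_cod (atlas a)) (f \o chart_inv (atlas a)).

Definition smooth_complex (f : X -> R[i]) : Prop :=
  smooth_real (fun p => complex.Re (f p)) /\
  smooth_real (fun p => complex.Im (f p)).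

(* The Laplace-Beltrami operator, evaluated at p in the chart chart_at p. On
   smooth functions the coordinate expression at p is the same in all charts
   around p, by metric_compat. *)
Definition laplace_beltrami_real (f : X -> R) (p : X) : R :=
  let a := chart_at p in
  laplace_coord (metric a) (f \o chart_inv (atlas a)) (chart_map (atlas a) p).

Definition laplace_beltrami (f : X -> R[i]) (p : X) : R[i] :=
  Complex (laplace_beltrami_real (fun q => complex.Re (f q)) p)
          (laplace_beltrami_real (fun q => complex.Im (f q)) p).

End ManifoldFunctions.

Record graph := Graph {
  vertex :> choiceType;
  adj : rel vertex;
  adj_sym : symmetric adj;
  adj_irr : irreflexive adj;
  adj_finite : forall x, finite_set [set y | adj x y]
}.

Section Graphs.
Variable X : graph.

Definition nbr (x : X) : {fset X} := fset_set [set y | adj x y].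

Definition valency (x : X) : nat := size (nbr x).

Definition bounded_valency : Prop :=
  exists d : nat, forall x : X, (valency x <= d)%N.

Definition graph_connected : Prop :=
  forall x y : X, exists p : seq X, path (@adj X) x p /\ last x p = y.

(* An isolated vertex has an empty sum, so the value there is 0. *)
Definition graph_laplacian (R : realType) (f : X -> R[i]) (x : X) : R[i] :=
  (valency x)%:R^-1 * \sum_(y <- nbr x) (f y - f x).

End Graphs.

Section Conditions.
Variables (R : realType) (X : Type) (Delta : (X -> R[i]) -> X -> R[i]).
Implicit Type phi : X -> R[i].

Definition harmonic phi : Prop := forall x, Delta phi x = 0.

Definition holomorphic phi : Prop :=
  harmonic phi /\ harmonic (fun x => phi x ^+ 2).

Definition star (N : nat) phi : Prop :=
  forall k : nat, (1 <= k <= N)%N -> harmonic (fun x => phi x ^+ k).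

Definition star_infty phi : Prop :=
  forall k : nat, (1 <= k)%N -> harmonic (fun x => phi x ^+ k).

End Conditions.

(* Main.v *)
Require Import Defs.
From mathcomp Require Import all_boot all_order all_algebra finmap.
From mathcomp Require Import complex cyclic separable cyclotomic ring.
From mathcomp Require Import all_classical all_reals all_analysis.

(* (1) In a chart, Delta (f g) = f Delta g + g Delta f + 2 <grad f, grad g>,
   with the inner product extended complex-bilinearly. So star 2 amounts to
   Delta phi = 0 and <grad phi, grad phi> = 0, and the Leibniz rule gives
   Delta (phi^k) = 0 by induction on k.
   (2) In two copies of the complex numbers, join w in the first to w + zeta in
   the second for each (N+1)-th root of unity zeta, and project onto the complex
   numbers. The power sums of the roots of unity of exponents 1, .., N vanish,
   that of exponent N+1 does not.
   (3) star m makes every polynomial of degree at most m in phi harmonic; if m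
   bounds the valency, this forces phi to be locally constant. *)

Set Implicit Arguments.
Unset Strict Implicit.
Unset Printing Implicit Defensive.

Import Order.TTheory GRing.Theory Num.Theory.
Import numFieldNormedType.Exports.

Local Open Scope ring_scope.

(** * Directional derivatives of determinants, adjugates and square roots *)

Section Derivable.
Variables (R : realType) (V : normedModType R).
Implicit Types (f g : V -> R) (x v : V).

Lemma derivable_bigsum (I : Type) (r : seq I) (h : I -> V -> R) x v :
  (forall i, derivable (h i) x v) ->
  derivable (fun y => \sum_(i <- r) h i y) x v.
Proof.
move=> dh; elim: r => [|i r IHr].
  rewrite (_ : (fun _ => _) = cst 0); first exact: derivable_cst.
  by apply/funext => y; rewrite big_nil.
rewrite (_ : (fun _ => _) = h i + (fun y => \sum_(j <- r) h j y)).
  exact: (derivableD (dh i) IHr).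
by apply/funext => y; rewrite big_cons.
Qed.

Lemma derivable_bigprod (I : Type) (r : seq I) (h : I -> V -> R) x v :
  (forall i, derivable (h i) x v) ->
  derivable (fun y => \prod_(i <- r) h i y) x v.
Proof.
move=> dh; elim: r => [|i r IHr].
  rewrite (_ : (fun _ => _) = cst 1); first exact: derivable_cst.
  by apply/funext => y; rewrite big_nil.
rewrite (_ : (fun _ => _) = h i * (fun y => \prod_(j <- r) h j y)).
  exact: (derivableM (dh i) IHr).
by apply/funext => y; rewrite big_cons.
Qed.

Lemma derivable_det (m : nat) (A : V -> 'M[R]_m) x v :
  (forall i j, derivable (fun y => A y i j) x v) ->
  derivable (fun y => \det (A y)) x v.
Proof.
move=> dA; apply: derivable_bigsum => s.
by apply: derivableM; [exact: derivable_cst|exact: derivable_bigprod].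
Qed.

Lemma derivable_adj (m : nat) (A : V -> 'M[R]_m) x v :
  (forall i j, derivable (fun y => A y i j) x v) ->
  forall i j, derivable (fun y => (\adj (A y)) i j) x v.
Proof.
move=> dA i j.
rewrite (_ : (fun _ => _) =
    cst ((-1) ^+ (j + i)) * (fun y => \det (row' j (col' i (A y))))).
  apply: derivableM; first exact: derivable_cst.
  apply: derivable_det => k l.
  by rewrite (_ : (fun _ => _) = fun y => A y (lift j k) (lift i l)) //;
     apply/funext => y; rewrite !mxE.
by apply/funext => y; rewrite mxE.
Qed.

(** Either sign of [f x] will do: [Num.sqrt] is 0 on negative reals, so next to a negative value the
    composite is constant along the line. *)
Lemma derivable_sqrt_comp f x v : f x != 0 -> derivable f x v ->
  derivable (fun y => Num.sqrt (f y)) x v.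
Proof.
(* Restricting to the line through [x] along [v] gives continuity, which a directional derivative of
   [f] does not give on the whole space. *)
move=> fx0 /derivable1P df; apply/derivable1P.
set g := fun h => f (h *: v + x) in df *.
have g0 : g 0 = f x by rewrite /g scale0r add0r.
have gc : {for 0, continuous g}.
  exact/differentiable_continuous/derivable1_diffP.
have [fx|fx] : f x < 0 \/ 0 < f x by apply/orP; rewrite -neq_lt.
  apply: (@near_eq_derivable _ _ _ (cst 0)); last exact: derivable_cst.
  have : \forall t \near 0, g t < 0.
    by apply: (cvgr_lt (g 0) gc); rewrite g0.
  by apply: filterS => t gt; rewrite ltr0_sqrtr.
apply/derivable1_diffP/differentiable_comp; first exact/derivable1_diffP.
apply/derivable1_diffP; rewrite -/(g 0) g0.
by have [] := is_derive1_sqrt fx.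
Qed.

End Derivable.

(** * Leibniz rules for the Laplacian in a chart *)

Section Laplacian.
Variables (R : realType) (n : nat) (G : 'rV[R]_n -> 'M[R]_n) (x : 'rV[R]_n).
Implicit Types f g h : 'rV[R]_n -> R.

(** First partials must exist on a neighbourhood because their sum and product rules are
    differentiated once more at [x]. *)
Definition C2at f : Prop :=
  (\forall y \near x, forall i : 'I_n, derivable f y (delta_mx 0 i)) /\
  forall i j : 'I_n, derivable (partial j f) x (delta_mx 0 i).

Lemma C2at_derivable f i : C2at f -> derivable f x (delta_mx 0 i).
Proof. by case=> /nbhs_singleton. Qed.

Lemma partialD_near f g : C2at f -> C2at g ->
  \forall y \near x,
    forall i, partial i (f + g) y = partial i f y + partial i g y.
Proof.
move=> [df _] [dg _]; apply: filterS2 df dg => y df dg i.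
exact: deriveD.
Qed.

Lemma partialM_near f g : C2at f -> C2at g ->
  \forall y \near x,
    forall i, partial i (f * g) y = f y * partial i g y + g y * partial i f y.
Proof.
move=> [df _] [dg _]; apply: filterS2 df dg => y df dg i.
exact: deriveM.
Qed.

Lemma C2atD f g : C2at f -> C2at g -> C2at (f + g).
Proof.
move=> cf cg; split=> [|i j].
  case: cf cg => [df _] [dg _]; apply: filterS2 df dg => y df dg i.
  exact: derivableD.
apply: (@near_eq_derivable _ _ _ (partial j f + partial j g)).
  by apply: filterS (partialD_near cf cg) => y /(_ j) ->.
by apply: derivableD; [case: cf|case: cg].
Qed.

Lemma C2atM f g : C2at f -> C2at g -> C2at (f * g).
Proof.
move=> cf cg; split=> [|i j].
  case: cf cg => [df _] [dg _]; apply: filterS2 df dg => y df dg i.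
  exact: derivableM.
apply: (@near_eq_derivable _ _ _ (f * partial j g + g * partial j f)).
  by apply: filterS (partialM_near cf cg) => y /(_ j) ->.
have [[_ df] [_ dg]] := (cf, cg).
by apply: derivableD; apply: derivableM => //; exact: C2at_derivable.
Qed.

Lemma C2at_cst (c : R) : C2at (cst c).
Proof.
split=> [|i j]; first by apply: filterE => y i; exact: derivable_cst.
rewrite (_ : partial j (cst c) = cst 0); first exact: derivable_cst.
by apply/funext => y; rewrite /partial derive_cst.
Qed.

(** Component [i] of the gradient of [f] times the volume density; the Laplacian is the divergence
    of this field over the density. *)
Definition flux f (i : 'I_n) : 'rV[R]_n -> R :=
  fun y => Num.sqrt (\det (G y)) * \sum_j invmx (G y) i j * partial j f y.

(* Twice the inner product of the gradients of f and g at x. *)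
Definition carre f g : R :=
  (Num.sqrt (\det (G x)))^-1 *
  \sum_i (partial i f x * flux g i x + partial i g x * flux f i x).

Lemma laplace_coordE f :
  laplace_coord G f x =
  (Num.sqrt (\det (G x)))^-1 * \sum_i partial i (flux f i) x.
Proof. by []. Qed.

Lemma fluxD_near f g : C2at f -> C2at g ->
  \forall y \near x, forall i, flux (f + g) i y = flux f i y + flux g i y.
Proof.
move=> cf cg; apply: filterS (partialD_near cf cg) => y fgy i.
rewrite /flux -mulrDr -big_split /=; congr (_ * _).
by apply: eq_bigr => j _; rewrite fgy mulrDr.
Qed.

Lemma fluxM_near f g : C2at f -> C2at g ->
  \forall y \near x,
    forall i, flux (f * g) i y = f y * flux g i y + g y * flux f i y.
Proof.
move=> cf cg; apply: filterS (partialM_near cf cg) => y fgy i.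
rewrite /flux [f y * _]mulrCA [g y * _]mulrCA -mulrDr; congr (_ * _).
rewrite !mulr_sumr -big_split /=.
by apply: eq_bigr => j _; rewrite fgy mulrDr ![invmx _ _ _ * (_ * _)]mulrCA.
Qed.

Lemma carreDr f g h : C2at g -> C2at h ->
  carre f (g + h) = carre f g + carre f h.
Proof.
move=> cg ch; rewrite /carre -mulrDr -big_split /=; congr (_ * _).
apply: eq_bigr => i _.
rewrite (nbhs_singleton (fluxD_near cg ch)).
rewrite (nbhs_singleton (partialD_near cg ch)).
by rewrite mulrDr mulrDl addrACA.
Qed.

Lemma carreMr f g h : C2at g -> C2at h ->
  carre f (g * h) = g x * carre f h + h x * carre f g.
Proof.
move=> cg ch; rewrite /carre [g x * _]mulrCA [h x * _]mulrCA -mulrDr.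
congr (_ * _).
rewrite !mulr_sumr -big_split /=; apply: eq_bigr => i _.
rewrite (nbhs_singleton (fluxM_near cg ch)).
rewrite (nbhs_singleton (partialM_near cg ch)).
by ring.
Qed.

Hypothesis G_unit : \forall y \near x, G y \in unitmx.
Hypothesis G_derivable :
  forall i j k : 'I_n, derivable (fun y => G y i j) x (delta_mx 0 k).

Lemma derivable_flux f (i k : 'I_n) : C2at f ->
  derivable (flux f i) x (delta_mx 0 k).
Proof.
move=> [_ df].
have detG0 : \det (G x) != 0.
  by rewrite -unitfE; have := nbhs_singleton G_unit; rewrite unitmxE.
have ddet : derivable (fun y => \det (G y)) x (delta_mx 0 k).
  by apply: derivable_det => a b; exact: G_derivable.
apply: derivableM; first exact: derivable_sqrt_comp.
apply: derivable_bigsum => j; apply: derivableM; last exact: df.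
(* [invmx] agrees with the adjugate over the determinant at invertible matrices, hence the appeal to
   invertibility near [x]. *)
apply: (@near_eq_derivable _ _ _
   ((fun y => (\det (G y))^-1) * (fun y => (\adj (G y)) i j))).
  by apply: filterS G_unit => y Gy; rewrite /invmx Gy mxE.
apply: derivableM; first exact: derivableV.
by apply: derivable_adj => a b; exact: G_derivable.
Qed.

Lemma laplace_coordD f g : C2at f -> C2at g ->
  laplace_coord G (f + g) x = laplace_coord G f x + laplace_coord G g x.
Proof.
move=> cf cg; rewrite !laplace_coordE -mulrDr -big_split /=; congr (_ * _).
apply: eq_bigr => i _.
rewrite [LHS](@near_eq_derive _ _ _ _ (flux f i + flux g i)).
  by rewrite /partial deriveD //; exact: derivable_flux.
by apply: filterS (fluxD_near cf cg) => y ->.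
Qed.

(** Differentiating [f * flux g i + g * flux f i] and summing over [i] gives the two Laplacians; the
    cross terms make up [carre]. *)
Lemma laplace_coordM f g : C2at f -> C2at g ->
  laplace_coord G (f * g) x =
  f x * laplace_coord G g x + g x * laplace_coord G f x + carre f g.
Proof.
move=> cf cg; rewrite !laplace_coordE /carre.
rewrite [f x * _]mulrCA [g x * _]mulrCA -!mulrDr.
congr (_ * _); rewrite !mulr_sumr -!big_split /=; apply: eq_bigr => i _.
rewrite [LHS](@near_eq_derive _ _ _ _ (f * flux g i + g * flux f i)).
  have [df dg] := (@C2at_derivable f i cf, @C2at_derivable g i cg).
  have [Ff Fg] := (@derivable_flux f i i cf, @derivable_flux g i i cg).
  rewrite (deriveD (derivableM df Fg) (derivableM dg Ff)).
  rewrite (deriveM df Fg) (deriveM dg Ff) addrACA; congr (_ + (_ + _)).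
    exact: mulrC.
  exact: mulrC.
by apply: filterS (fluxM_near cf cg) => y ->.
Qed.

End Laplacian.

(** * Leibniz rules for complex-valued functions *)

Section ComplexLaplacian.
Variables (R : realType) (n : nat) (G : 'rV[R]_n -> 'M[R]_n) (x : 'rV[R]_n).
Hypothesis G_unit : \forall y \near x, G y \in unitmx.
Hypothesis G_derivable :
  forall i j k : 'I_n, derivable (fun y => G y i j) x (delta_mx 0 k).
Implicit Types (f g h : 'rV[R]_n -> R) (w z t : 'rV[R]_n -> R[i]).

Local Notation Lap := (laplace_coord G).
Local Notation C2 := (C2at x).
Local Notation car := (carre G x).

Lemma C2atB f g : C2 f -> C2 g -> C2 (f - g).
Proof.
move=> cf cg; rewrite (_ : f - g = f + cst (-1) * g).
  exact: C2atD cf (C2atM (C2at_cst x (-1)) cg).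
by apply/funext => y; rewrite -[RHS]/(f y + (-1) * g y) mulN1r.
Qed.

Lemma laplace_coordB f g : C2 f -> C2 g -> Lap (f - g) x = Lap f x - Lap g x.
Proof.
move=> cf cg; apply/eqP; rewrite eq_sym subr_eq.
by rewrite -(laplace_coordD G_unit G_derivable (C2atB cf cg) cg) subrK.
Qed.

Lemma carreBr f g h : C2 g -> C2 h -> car f (g - h) = car f g - car f h.
Proof.
move=> cg ch; apply/eqP; rewrite eq_sym subr_eq.
by rewrite -(carreDr _ _ (C2atB cg ch) ch) subrK.
Qed.

Definition rpart w : 'rV[R]_n -> R := fun y => complex.Re (w y).
Definition ipart w : 'rV[R]_n -> R := fun y => complex.Im (w y).
Definition cmul w z : 'rV[R]_n -> R[i] := fun y => w y * z y.

Definition cC2at w : Prop := C2 (rpart w) /\ C2 (ipart w).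
Definition claplace w : R[i] := Complex (Lap (rpart w) x) (Lap (ipart w) x).
(** [carre] extended complex-bilinearly, without conjugation, so that [ccarre w w] can vanish for
    nonconstant [w]. *)
Definition ccarre w z : R[i] :=
  Complex (car (rpart w) (rpart z) - car (ipart w) (ipart z))
          (car (rpart w) (ipart z) + car (ipart w) (rpart z)).

Lemma rpartM w z : rpart (cmul w z) = rpart w * rpart z - ipart w * ipart z.
Proof.
apply/funext => y.
rewrite -[RHS]/(rpart w y * rpart z y - ipart w y * ipart z y) /rpart /ipart.
by rewrite /cmul; case: (w y) (z y) => a b [c d].
Qed.

Lemma ipartM w z : ipart (cmul w z) = rpart w * ipart z + ipart w * rpart z.
Proof.
apply/funext => y.
rewrite -[RHS]/(rpart w y * ipart z y + ipart w y * rpart z y) /rpart /ipart.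
by rewrite /cmul; case: (w y) (z y) => a b [c d].
Qed.

Lemma cC2atM w z : cC2at w -> cC2at z -> cC2at (cmul w z).
Proof.
move=> [rw iw] [rz iz]; rewrite /cC2at rpartM ipartM.
split; first exact: C2atB (C2atM rw rz) (C2atM iw iz).
exact: C2atD (C2atM rw iz) (C2atM iw rz).
Qed.

Lemma claplaceM w z : cC2at w -> cC2at z ->
  claplace (cmul w z) = w x * claplace z + z x * claplace w + ccarre w z.
Proof.
move=> [rw iw] [rz iz]; rewrite /claplace rpartM ipartM /ccarre.
have lapM := laplace_coordM G_unit G_derivable.
rewrite (laplace_coordB (C2atM rw rz) (C2atM iw iz)).
rewrite (laplace_coordD G_unit G_derivable (C2atM rw iz) (C2atM iw rz)).
rewrite (lapM _ _ rw rz) (lapM _ _ iw iz) (lapM _ _ rw iz) (lapM _ _ iw rz).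
move: (Lap _ x) (Lap _ x) (Lap _ x) (Lap _ x) (car _ _) (car _ _) (car _ _)
  (car _ _) => l1 l2 l3 l4 c1 c2 c3 c4.
rewrite /rpart /ipart; case: (w x) (z x) => a b [c d] /=.
by apply/eqP; rewrite eq_complex /=; apply/andP; split; apply/eqP; ring.
Qed.

Lemma ccarreMr w z t : cC2at z -> cC2at t ->
  ccarre w (cmul z t) = z x * ccarre w t + t x * ccarre w z.
Proof.
move=> [rz iz] [rt it]; rewrite /ccarre rpartM ipartM.
rewrite !(carreBr _ (C2atM rz rt) (C2atM iz it)).
rewrite !(carreDr _ _ (C2atM rz it) (C2atM iz rt)).
rewrite !(carreMr _ _ rz rt) !(carreMr _ _ iz it).
rewrite !(carreMr _ _ rz it) !(carreMr _ _ iz rt).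
move: (car _ _) (car _ _) (car _ _) (car _ _) (car _ _) (car _ _) (car _ _)
  (car _ _) => c1 c2 c3 c4 c5 c6 c7 c8.
rewrite /rpart /ipart; case: (z x) (t x) => a b [c d] /=.
by apply/eqP; rewrite eq_complex /=; apply/andP; split; apply/eqP; ring.
Qed.

Lemma claplace_exp w (k : nat) : cC2at w -> claplace w = 0 ->
  claplace (fun y => w y ^+ 2) = 0 -> claplace (fun y => w y ^+ k.+1) = 0.
Proof.
move=> cw Lw Lw2.
have wS j : (fun y => w y ^+ j.+2) = cmul w (fun y => w y ^+ j.+1).
  by apply/funext => y; rewrite exprS.
have cww : ccarre w w = 0.
  by move: Lw2; rewrite wS (claplaceM cw cw) Lw mulr0 !add0r.
(* The induction carries the vanishing of [ccarre] between [w] and its power along, since the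
   product rule for the next power calls for it. *)
have main j : [/\ cC2at (fun y => w y ^+ j.+1),
    claplace (fun y => w y ^+ j.+1) = 0 & ccarre w (fun y => w y ^+ j.+1) = 0].
  elim: j => [|j [cj Lj wj]]; first exact: And3 cw Lw cww.
  rewrite wS; split; first exact: cC2atM cw cj.
    by rewrite (claplaceM cw cj) Lj Lw wj !mulr0 !addr0.
  by rewrite (ccarreMr _ cw cj) wj cww !mulr0 addr0.
by case: (main k).
Qed.

End ComplexLaplacian.

(** * Riemannian manifolds *)

Section Manifold.
Variables (R : realType) (n : nat).

Lemma smooth_on_C2at (A : set 'rV[R]_n) (u : 'rV[R]_n -> R) (x : 'rV[R]_n) :
  open A -> A x -> smooth_on A u -> C2at x u.
Proof.
move=> oA Ax su; split=> [|i j]; last by have [_ /(_ i)] := su [:: j] x Ax.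
apply: filterS (open_nbhs_nbhs (conj oA Ax)) => y Ay i.
by have [_ /(_ i)] := su [::] y Ay.
Qed.

(** A singular matrix kills some nonzero row vector, and the quadratic form vanishes there. *)
Lemma posdef_unitmx (A : 'M[R]_n) :
  (forall v : 'rV[R]_n, v != 0 -> 0 < (v *m A *m v^T) 0 0) -> A \in unitmx.
Proof.
move=> posA; rewrite unitmxE unitfE; apply/det0P => -[v v0 vA].
by have := posA v v0; rewrite vA mul0mx mxE ltxx.
Qed.

(** The operator at [p] is by definition the coordinate expression in the chart [chart_at p], so the
    local computation in that one chart suffices. *)
Lemma manifold_star2_infty (X : riemannianManifold R n) (phi : X -> R[i]) :
  smooth_complex phi -> star (@laplace_beltrami R n X) 2 phi ->
  star_infty (@laplace_beltrami R n X) phi.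
Proof.
move=> [sr si] st [//|k] _ p.
pose a := chart_at p; pose x := chart_map (atlas a) p.
have Ax : chart_cod (atlas a) x by apply/chart_map_cod/mem_chart_at.
have oA := @chart_cod_open _ _ _ (atlas a).
have Gu : \forall y \near x, metric a y \in unitmx.
  apply: filterS (open_nbhs_nbhs (conj oA Ax)) => y Ay.
  by apply: posdef_unitmx => v; exact: metric_pos.
have Gd i j l : derivable (fun y => metric a y i j) x (delta_mx 0 l).
  by have [_ /(_ l)] := @metric_smooth _ _ X a i j [::] x Ax.
apply: (claplace_exp (w := phi \o chart_inv (atlas a)) Gu Gd).
- by split; [apply: smooth_on_C2at (sr a)|apply: smooth_on_C2at (si a)].
(* The first power is convertible to the function itself. *)
- exact: (st 1%N isT p).
- exact: (st 2%N isT p).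
Qed.

End Manifold.

(** As [n] is nonzero in [F], X^n - 1 is separable and has [n] distinct roots; [n] distinct n-th
    roots of unity in a field include a primitive one. *)
Lemma closed_prim_root_exists (F : closedFieldType) (n : nat) :
  (0 < n)%N -> n%:R != 0 :> F -> exists z : F, n.-primitive_root z.
Proof.
move=> n_gt0 nF0; pose p : {poly F} := 'X^n - 1.
have [r Dp] := closed_field_poly_normal p.
rewrite (monicP _) ?monicXnsubC // scale1r in Dp.
have rn1: all n.-unity_root r by apply/allP=> z; rewrite -root_prod_XsubC -Dp.
have sz_r: (n < (size r).+1)%N.
  by rewrite -(size_prod_XsubC r id) -Dp size_XnsubC.
have [|z] := hasP (has_prim_root n_gt0 rn1 _ sz_r); last by exists z.
by rewrite -separable_prod_XsubC -Dp separable_Xn_sub_1.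
Qed.

(** * Graphs of bounded valency *)

Section Graphs.
Variable X : graph.

Lemma in_nbr (x y : X) : (y \in nbr x) = adj x y.
Proof.
rewrite /nbr in_fset_set; last exact: adj_finite.
by apply/idP/idP; rewrite inE.
Qed.

Variable R : realType.
Implicit Types (phi : X -> R[i]) (p : {poly R[i]}).

(** The inverse of the valency is zero only at an isolated vertex, where the sum is empty. *)
Lemma graph_laplacian_eq0 (f : X -> R[i]) (x : X) :
  graph_laplacian f x = 0 <-> \sum_(y <- nbr x) (f y - f x) = 0.
Proof.
rewrite /graph_laplacian; split=> [/eqP|->]; last by rewrite mulr0.
rewrite mulf_eq0 invr_eq0 pnatr_eq0 => /orP[|/eqP //].
by rewrite /valency size_eq0 => /eqP ->; rewrite big_nil.
Qed.

Lemma star_poly (m : nat) phi p (x : X) :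
  star (@graph_laplacian X R) m phi -> (size p <= m.+1)%N ->
  \sum_(y <- nbr x) (p.[phi y] - p.[phi x]) = 0.
Proof.
move=> st sp.
rewrite (eq_bigr (fun y => \sum_(k < size p) p`_k * (phi y ^+ k - phi x ^+ k))).
  rewrite exchange_big big1 //= => -[[|k] kp] _ /=.
    (* Exponent 0 is outside [star], but constants cancel in the differences. *)
    by rewrite big1 // => y _; rewrite !expr0 subrr mulr0.
  rewrite -mulr_sumr (graph_laplacian_eq0 _ _).1 ?mulr0 // st //=.
  by rewrite -ltnS (leq_trans kp).
move=> y _; rewrite !horner_coef -sumrB.
by apply: eq_bigr => k _; rewrite mulrBr.
Qed.

(* Test against the polynomial vanishing at the values of phi at x and at the
   neighbours of x, except at phi y. *)
Lemma star_adj_eq (m : nat) phi (x y : X) :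
  star (@graph_laplacian X R) m phi -> (valency x <= m)%N -> adj x y ->
  phi y = phi x.
Proof.
move=> st vm xy; apply/eqP/negP => /negP yx.
pose s := undup (phi x :: map phi (nbr x)).
have sx : phi x \in s by rewrite mem_undup inE eqxx.
have sn z : adj x z -> phi z \in s.
  by move=> xz; rewrite mem_undup inE map_f ?orbT ?in_nbr.
have sy := sn y xy.
pose p := \prod_(z <- rem (phi y) s) ('X - z%:P).
(* [s] has at most [valency x + 1] values; dropping [phi y] leaves at most [m] linear factors. *)
have szp : (size p <= m.+1)%N.
  rewrite size_prod_XsubC size_rem // prednK; last by case: (s) sy.
  by rewrite (leq_trans (size_undup _)) //= size_map.
have p0 z : z \in s -> z != phi y -> p.[z] = 0.
  move=> zs zy; apply/eqP; rewrite -[_ == 0]/(root p z) root_prod_XsubC.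
  by rewrite mem_rem_uniq ?undup_uniq // inE zy.
have py : p.[phi y] != 0.
  rewrite -[_ == 0]/(root p (phi y)) root_prod_XsubC.
  by rewrite mem_rem_uniq ?undup_uniq // inE eqxx.
have := star_poly x st szp.
(* The sum is [p.[phi y]] times the number of neighbours where [phi] takes the value [phi y], and
   [y] is one of them. *)
rewrite (eq_big_seq (fun z => p.[phi y] * (phi z == phi y)%:R)).
  apply/eqP; rewrite -mulr_sumr mulf_neq0 // -natr_sum pnatr_eq0.
  by rewrite (big_rem y) ?in_nbr //= eqxx.
move=> z; rewrite in_nbr => xz.
rewrite [p.[phi x]](_ : _ = 0) ?subr0; last by rewrite p0 // eq_sym.
have [->|zy] := eqVneq (phi z) (phi y); first by rewrite mulr1.
by rewrite (p0 _ (sn _ xz) zy) mulr0.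
Qed.

Lemma graph_star_const (m : nat) phi :
  graph_connected X -> (forall x : X, (valency x <= m)%N) ->
  star (@graph_laplacian X R) m phi -> exists c, forall x, phi x = c.
Proof.
move=> conX vm st.
(* An empty graph has no vertex to read the constant from. *)
have [[x0]|X0] := pselect (inhabited X); last first.
  by exists 0 => x; case: X0.
exists (phi x0) => x; have [p [+ <-]] := conX x0 x.
elim: p x0 => //= y p IHp x0 /andP[x0y /IHp ->].
exact: star_adj_eq st (vm _) x0y.
Qed.

End Graphs.

(** * The graph built from roots of unity *)

Section RootGraph.
Variables (R : realType) (n : nat) (z : R[i]).
Hypotheses (prim_z : n.-primitive_root z).

(** The boolean names the copy of the complex numbers; roots are added when leaving [false] and
    subtracted when leaving [true], which makes adjacency symmetric. *)
Definition root_shifts (x : bool * R[i]) : seq (bool * R[i]) :=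
  [seq (~~ x.1, x.2 + (-1) ^+ x.1 * z ^+ j) | j <- iota 0 n].

Lemma root_shifts_sym : symmetric (fun x y => y \in root_shifts x).
Proof.
suff imp x y : y \in root_shifts x -> x \in root_shifts y.
  by move=> x y; apply/idP/idP; apply: imp.
case/mapP => j jn ->; apply/mapP; exists j => //=.
by case: x => b w; rewrite /= negbK; case: b; rewrite /= ?expr0 ?expr1 ?mulN1r
  ?mul1r ?addrK ?subrK.
Qed.

Lemma root_shifts_irr : irreflexive (fun x y => y \in root_shifts x).
Proof. by case=> b w; apply/negP => /mapP[j _ [/eqP]]; case: b. Qed.

Lemma root_shifts_finite (x : bool * R[i]) :
  finite_set [set y | y \in root_shifts x].
Proof. exact: finite_seq. Qed.

Definition root_graph : graph :=
  Graph root_shifts_sym root_shifts_irr root_shifts_finite.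

(** The first [n] powers of a primitive root are distinct, so the list of shifts has no
    repetition. *)
Lemma nbr_root_graph (x : root_graph) (f : root_graph -> R[i]) :
  \sum_(y <- nbr x) f y = \sum_(y <- root_shifts x) f y.
Proof.
apply: perm_big; apply: uniq_perm; first exact: fset_uniq.
  rewrite map_inj_in_uniq ?iota_uniq // => i j.
  rewrite !mem_iota add0n => /andP[_ ni] /andP[_ nj] [] /addrI /mulfI.
  rewrite signr_eq0 => /(_ isT) /eqP.
  by rewrite (eq_prim_root_expr prim_z) !modn_small // => /eqP.
by move=> y; rewrite in_nbr.
Qed.

(** A geometric sum of ratio z^k, where z^k differs from 1 and its n-th power is 1. *)
Lemma sum_prim_root_exp (k : nat) :
  (0 < k < n)%N -> \sum_(0 <= j < n) (z ^+ j) ^+ k = 0.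
Proof.
case/andP=> k0 kn.
under eq_bigr do rewrite exprAC.
have : (z ^+ k - 1) * \sum_(0 <= j < n) (z ^+ k) ^+ j = 0.
  by rewrite big_mkord -subrX1 exprAC (prim_expr_order prim_z) expr1n subrr.
move/eqP; rewrite mulf_eq0 subr_eq0 -(prim_order_dvd prim_z) => /orP[|/eqP //].
by move=> /(dvdn_leq k0); rewrite leqNgt kn.
Qed.

(** In the binomial expansion w^k cancels and each other term carries a power sum of exponent
    between 1 and [k]; only exponent [n] survives. *)
Lemma sum_prim_root_shift (w s : R[i]) (k : nat) :
  (0 < k <= n)%N ->
  \sum_(0 <= j < n) ((w + s * z ^+ j) ^+ k - w ^+ k) =
  if k == n then n%:R * s ^+ n else 0.
Proof.
case/andP=> k0 kn.
rewrite (eq_bigr (fun j => \sum_(i < k)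
    (w ^+ (k - i.+1) * s ^+ i.+1 *+ 'C(k, i.+1)) * (z ^+ j) ^+ i.+1));
  last first.
  move=> j _; rewrite exprDn big_ord_recl subn0 expr0 mulr1 bin0 mulr1n.
  rewrite addrC addKr; apply: eq_bigr => i _.
  by rewrite lift0 mulrnAl -mulrA -exprMn.
rewrite exchange_big /=; case: k k0 kn => // k _ kn.
(* The top exponent is split off, since it alone can reach [n]. *)
rewrite big_ord_recr big1 /= ?add0r => [|i _]; rewrite -mulr_sumr; last first.
  by rewrite sum_prim_root_exp ?mulr0 // (leq_ltn_trans _ kn).
rewrite subnn expr0 mul1r binn mulr1n.
case: eqVneq => [->|kn']; last first.
  by rewrite sum_prim_root_exp ?mulr0 //= ltn_neqAle kn'.
under eq_bigr do rewrite exprAC (prim_expr_order prim_z) expr1n.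
by rewrite sumr_const_nat subn0 mulrC.
Qed.

Lemma root_graph_laplacian (k : nat) (x : root_graph) : (0 < k <= n)%N ->
  graph_laplacian (fun y : root_graph => y.2 ^+ k) x =
  if k == n then (valency x)%:R^-1 * (n%:R * ((-1) ^+ x.1) ^+ n) else 0.
Proof.
move=> kn; rewrite /graph_laplacian nbr_root_graph big_map.
rewrite -[n in iota 0 n]subn0 sum_prim_root_shift //.
by case: eqP; rewrite ?mulr0.
Qed.

(** Summing the constant 1 over both enumerations compares their lengths inside [R[i]], which has
    characteristic zero. *)
Lemma valency_root_graph (x : root_graph) : valency x = n.
Proof.
have := nbr_root_graph x (fun=> 1).
rewrite big_const_seq count_predT iter_addr_0 [in RHS]big_map.
rewrite big_const_seq count_predT iter_addr_0 size_iota => /eqP.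
by rewrite eqr_nat => /eqP.
Qed.

End RootGraph.

Lemma graph_star_sharp (R : realType) (N : nat) :
  exists (X : graph) (phi : X -> R[i]),
    star (@graph_laplacian X R) N phi /\
    ~ star (@graph_laplacian X R) N.+1 phi.
Proof.
have [||z prim_z] := @closed_prim_root_exists R[i] N.+1; rewrite ?pnatr_eq0 //.
exists (root_graph N.+1 z), snd; split=> [k /andP[k0 kN] x|].
  by rewrite root_graph_laplacian ?k0 ?leqW // ltn_eqF.
(* At this vertex the sign is +1 and the Laplacian of the power N+1 equals 1. *)
move=> /(_ N.+1 (leqnn _) (false, 0)) /eqP.
rewrite root_graph_laplacian //= eqxx valency_root_graph // expr1n mulr1.
by rewrite mulVf ?oner_eq0 // pnatr_eq0.
Qed.

(** * The three claims assembled *)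

Theorem theorem1p2 (R : realType) :
  [/\ (forall (n : nat) (X : riemannianManifold R n) (phi : X -> R[i]),
         smooth_complex phi ->
         (star (@laplace_beltrami R n X) 2 phi ->
            star_infty (@laplace_beltrami R n X) phi) /\
         (holomorphic (@laplace_beltrami R n X) phi ->
            forall N : nat, (1 <= N)%N ->
              star (@laplace_beltrami R n X) N phi)),
      (forall N : nat, (2 < N)%N ->
         exists (X : graph) (phi : X -> R[i]),
           [/\ holomorphic (@graph_laplacian X R) phi,
               star (@graph_laplacian X R) N phi &
               ~ star (@graph_laplacian X R) N.+1 phi]) &
      (forall X : graph, graph_connected X -> bounded_valency X ->
         exists m : nat, (1 <= m)%N /\
           forall phi : X -> R[i], star (@graph_laplacian X R) m phi ->
             (exists c : R[i], forall x : X, phi x = c) /\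
             star_infty (@graph_laplacian X R) phi)].
Proof.
split=> [n X phi sphi|N N2|X conX [d vd]].
- have st2 := manifold_star2_infty sphi; split; first exact: st2.
  move=> [h1 h2] N _ k /andP[k1 _]; apply: (st2 _ k k1).
  by case=> [|[|[|l]]] l2; [discriminate|exact: h1|exact: h2|discriminate].
- have [X [phi [stN nstN]]] := graph_star_sharp R N.
  exists X, phi; split=> //; split; last exact: stN 2%N (ltnW N2).
  exact: stN 1%N (ltnW (ltnW N2)).
(* [d.+1] rather than [d]: the exponent must be positive, while the bound [d] may be 0. *)
- exists d.+1; split=> // phi st.
  have [c phic] : exists c, forall x, phi x = c.
    by apply: graph_star_const conX _ st => x; rewrite leqW.
  split=> [|k _ x]; first by exists c.
  rewrite graph_laplacian_eq0 big1 // => y _.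
  by rewrite !phic subrr.
Qed.
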